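(* Let $1<p<\infty$, $q,Q,t\in\mathbb{R}$, $s>-1$, with $s+t<-(N+1)$ and $Q\le q$. Then there is no weight $\omega$ on $\mathbb{B}$ such that $P_{s,t}$ is well defined and continuous from $L^p(\omega\,d\mu_q)$ to $L^p(\omega\,d\mu_Q)$.
   Context: $N\ge1$; $\langle z,w\rangle=\sum_{j=1}^N z_j\overline{w_j}$, $|z|=\sqrt{\langle z,z\rangle}$ on $\mathbb{C}^N$; $\mathbb{B}$ is the open unit ball of $\mathbb{C}^N$; $\mu$ is normalized Lebesgue measure on $\mathbb{B}$; for $c\in\mathbb{R}$, $d\mu_c(z)=(1-|z|^2)^c d\mu(z)$. A weight is a positive (a.e.) locally integrable function on $\mathbb{B}$. For $a\le-(N+1)$, $K_a(z,w)=\sum_{k\ge0}\frac{k!}{(1-N-a)_k}\langle z,w\rangle^k$ with $(u)_k=\Gamma(u+k)/\Gamma(u)$. The operator is $P_{s,t}f(z)=(1-|z|^2)^t\int_{\mathbb{B}}K_{s+t}(z,w)f(w)(1-|w|^2)^{s}\,d\mu(w)$. ''Well defined and continuous'' means that for every $f\in L^p(\omega\,d\mu_q)$ the integral converges absolutely for almost every $z\in\mathbb{B}$, and $\|P_{s,t}f\|_{L^p(\omega\,d\mu_Q)}\le C\|f\|_{L^p(\omega\,d\mu_q)}$ with $C$ independent of $f$. *)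

(* Defs.v *)
From HB Require Import structures.
From mathcomp Require Import all_boot all_order all_algebra.
From mathcomp Require Import all_classical all_reals all_analysis.
From mathcomp.real_closed Require Export complex.

Set Implicit Arguments.
Unset Strict Implicit.
Unset Printing Implicit Defensive.

Import Order.TTheory GRing.Theory Num.Theory.
Import numFieldNormedType.Exports.

Local Open Scope classical_set_scope.
Local Open Scope ring_scope.
Local Open Scope complex_scope.

(* R[i] carries the Borel sigma-algebra of R * R, transported along
   z |-> (Re z, Im z). *)
Definition complex_display : measure_display.
Proof. exact: default_measure_display. Qed.

Section complex_measurable.
Variable R : realType.

Definition complex_to_pair (z : R[i]) : R * R :=
  (complex.Re z, complex.Im z).

Definition pair_to_complex (u : R * R) : R[i] := u.1 +i* u.2.

Definition complex_measurable : set (set R[i]) :=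
  preimage_set_system [set: R[i]] complex_to_pair measurable.

Let complex_sigma_algebra : sigma_algebra [set: R[i]] complex_measurable.
Proof. exact/sigma_algebra_preimage/sigma_algebra_measurable. Qed.

Let complex_measurable0 : complex_measurable set0.
Proof. by case: complex_sigma_algebra. Qed.

Let complex_measurableC A : complex_measurable A -> complex_measurable (~` A).
Proof. by case: complex_sigma_algebra => _ + _ => /[apply]; rewrite setTD. Qed.

Let complex_measurable_bigcup (F : (set R[i])^nat) :
  (forall i, complex_measurable (F i)) -> complex_measurable (\bigcup_i F i).
Proof. by case: complex_sigma_algebra => _ _; apply. Qed.

HB.instance Definition _ := isPointed.Build R[i] 0.

HB.instance Definition _ := @isMeasurable.Build complex_display R[i]
  complex_measurable complex_measurable0 complex_measurableC
  complex_measurable_bigcup.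

Lemma measurable_complex_to_pair : measurable_fun [set: R[i]] complex_to_pair.
Proof. by move=> _ Y mY; rewrite setTI; exists Y => //; rewrite setTI. Qed.

Lemma measurable_pair_to_complex :
  measurable_fun [set: R * R] pair_to_complex.
Proof.
move=> _ _ [B mB <-]; rewrite !setTI.
by rewrite (_ : _ @^-1` _ = B)//; apply/seteqP; split => -[x y].
Qed.

End complex_measurable.

Section sigma_finite_constructions.
Context d1 d2 (T1 : measurableType d1) (T2 : measurableType d2) (R : realType).

Lemma product_sigma_finite (m1 : {sigma_finite_measure set T1 -> \bar R})
    (m2 : {sigma_finite_measure set T2 -> \bar R}) :
  sigma_finite [set: T1 * T2] (m1 \x m2)%E.
Proof.
have /sigma_finiteP[F [TF ndF Foo]] := sigma_finiteT m1.
have /sigma_finiteP[G [TG ndG Goo]] := sigma_finiteT m2.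
exists (fun n => F n `*` G n).
  rewrite -setXTT TF TG predeqE => -[x y]; split => [|[n _ []]]; last first.
    by move=> Fnx Gny; split; exists n.
  move=> [/= [n _ Fnx] [k _ Gky]]; exists (maxn n k) => //; split.
  - by move: x Fnx; exact/subsetPset/ndF/leq_maxl.
  - by move: y Gky; exact/subsetPset/ndG/leq_maxr.
move=> k; have [mF Fk] := Foo k; have [mG Gk] := Goo k.
split; first exact: measurableX.
by rewrite product_measure1E// lte_mul_pinfty// ge0_fin_numE.
Qed.

Variables (m : {measure set T1 -> \bar R}) (sm : sigma_finite [set: T1] m).
Variables (f : T1 -> T2) (g : T2 -> T1).
Hypotheses (mf : measurable_fun [set: T1] f) (mg : measurable_fun [set: T2] g).
Hypothesis fK : cancel f g.

Lemma pushforward_sigma_finite : sigma_finite [set: T2] (pushforward m f).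
Proof.
have [F UF Foo] := sm.
exists (fun n => g @^-1` F n); first by rewrite -preimage_bigcup -UF.
move=> n; have [mF Fnoo] := Foo n; split.
  by rewrite -[X in measurable X]setTI; exact: mg.
rewrite /pushforward -comp_preimage (_ : g \o f = id)//.
by apply/funext => x /=; rewrite fK.
Qed.

Let mfm : {measure set T2 -> \bar R} :=
  measure_function_pushforward__canonical__measure_function_Measure m mf.

Definition pushforward_iso : {sigma_finite_measure set T2 -> \bar R} :=
  HB.pack_for {sigma_finite_measure set T2 -> \bar R} (Measure.sort mfm)
    (Measure_isSigmaFinite.Build _ _ _ (Measure.sort mfm)
      pushforward_sigma_finite).

End sigma_finite_constructions.

Section lebesgue_Cn.
Variable R : realType.

Lemma pair_to_complexK : cancel (@pair_to_complex R) (@complex_to_pair R).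
Proof. by case. Qed.

(* Lebesgue measure on C = R^2. The library puts lebesgue_measure on the copy
   measurableTypeR R of R. *)
Definition lebesgueC : {sigma_finite_measure set R[i] -> \bar R} :=
  @pushforward_iso _ _ (measurableTypeR R * measurableTypeR R)%type R[i] R
    (lebesgue_measure \x lebesgue_measure)%E
    (product_sigma_finite lebesgue_measure lebesgue_measure)
    _ _ (@measurable_pair_to_complex R) (@measurable_complex_to_pair R)
    pair_to_complexK.

Definition tcons n (u : R[i] * n.-tuple R[i]) : n.+1.-tuple R[i] :=
  [tuple of u.1 :: u.2].

Definition tuncons n (z : n.+1.-tuple R[i]) : R[i] * n.-tuple R[i] :=
  (thead z, [tuple of behead z]).

Lemma measurable_tcons n :
  measurable_fun [set: R[i] * n.-tuple R[i]] (@tcons n).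
Proof. exact: measurable_cons. Qed.

Lemma measurable_tuncons n :
  measurable_fun [set: n.+1.-tuple R[i]] (@tuncons n).
Proof.
by apply/measurable_fun_pair; [exact: measurable_tnth|exact: measurable_behead].
Qed.

Lemma tconsK n : cancel (@tcons n) (@tuncons n).
Proof. by move=> [a u]; congr pair; exact/val_inj. Qed.

(* Lebesgue measure on C^n: the n-fold product of lebesgueC. *)
Fixpoint lebesgueCn n : {sigma_finite_measure set (n.-tuple R[i]) -> \bar R} :=
  if n is n'.+1 then
    pushforward_iso (product_sigma_finite lebesgueC (lebesgueCn n'))
      (@measurable_tcons n') (@measurable_tuncons n') (@tconsK n')
  else \d_ [tuple].

End lebesgue_Cn.

Section unit_ball.
Variables (R : realType) (N : nat).
Implicit Types z w : N.-tuple R[i].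

Definition inner z w : R[i] := \sum_(j < N) tnth z j * (tnth w j)^*.

Definition enorm z : R := Num.sqrt (complex.Re (inner z z)).

Definition unit_ball : set (N.-tuple R[i]) := [set z | enorm z < 1].

Lemma unit_ball_scale_ge0 : 0 <= (fine (lebesgueCn R N unit_ball))^-1.
Proof. by rewrite invr_ge0 fine_ge0. Qed.

(* Lebesgue measure scaled so that unit_ball has measure 1; it is used only
   on subsets of unit_ball. *)
Definition mu : {measure set (N.-tuple R[i]) -> \bar R} :=
  mscale (NngNum unit_ball_scale_ge0) (lebesgueCn R N).

Definition to_rV z : 'rV[R[i]^o]_N := \row_j tnth z j.

Definition locally_integrable_ball (f : N.-tuple R[i] -> R) :=
  measurable_fun unit_ball f /\
  forall K : set (N.-tuple R[i]), K `<=` unit_ball ->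
    compact (to_rV @` K) -> (\int[mu]_(z in K) `|f z|%:E < +oo)%E.

Definition is_weight (om : N.-tuple R[i] -> R) :=
  locally_integrable_ball om /\ {ae mu, forall z, unit_ball z -> 0 < om z}.

(* The norm of L^p(om dmu_c), where dmu_c(z) = (1 - |z|^2)^c dmu(z). *)
Definition weighted_Lnorm (p : R) (om : N.-tuple R[i] -> R) (c : R)
    (f : N.-tuple R[i] -> R[i]) : \bar R :=
  ((\int[mu]_(z in unit_ball)
      (Normc.normc (f z) `^ p * om z * (1 - enorm z ^+ 2) `^ c)%:E) `^ p^-1)%E.

Definition weighted_Lp (p : R) (om : N.-tuple R[i] -> R) (c : R)
    (f : N.-tuple R[i] -> R[i]) :=
  measurable_fun unit_ball f /\ (weighted_Lnorm p om c f < +oo)%E.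

End unit_ball.
Arguments unit_ball R N : clear implicits.
Arguments mu R N : clear implicits.

Section operator.
Variables (R : realType) (N : nat).
Implicit Types z w : N.-tuple R[i].

(* Euler's integral, which is the Gamma function for u > 0 only. *)
Definition Gamma (u : R) : R :=
  \int[lebesgue_measure]_(x in `]0, +oo[) (x `^ (u - 1) * expR (- x)).

Definition pochhammer (u : R) (k : nat) : R := Gamma (u + k%:R) / Gamma u.

(* Meaningful for a <= - (N + 1), where 1 - N - a >= 2 and the series converges
   for z and w in the unit ball. *)
Definition bergman_kernel (a : R) z w : R[i] :=
  limn (fun n => \sum_(0 <= k < n)
    (k`!%:R / pochhammer (1 - N%:R - a) k)%:C * inner z w ^+ k : R[i]^o).

Definition bergman_integrand (s t : R) (f : N.-tuple R[i] -> R[i]) z w : R[i] :=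
  bergman_kernel (s + t) z w * f w * ((1 - enorm w ^+ 2) `^ s)%:C.

Definition bergman_op (s t : R) (f : N.-tuple R[i] -> R[i]) z : R[i] :=
  ((1 - enorm z ^+ 2) `^ t)%:C *
  ((\int[mu R N]_(w in unit_ball R N) complex.Re (bergman_integrand s t f z w))
   +i* \int[mu R N]_(w in unit_ball R N)
         complex.Im (bergman_integrand s t f z w)).

Definition bergman_op_bounded (p q Q s t : R) (om : N.-tuple R[i] -> R) :=
  (forall f, weighted_Lp p om q f ->
     {ae mu R N, forall z, unit_ball R N z ->
       (mu R N).-integrable (unit_ball R N)
         (fun w => (Normc.normc (bergman_integrand s t f z w))%:E)}) /\
  exists C : R, forall f, weighted_Lp p om q f ->
    (weighted_Lnorm p om Q (bergman_op s t f) <=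
       C%:E * weighted_Lnorm p om q f)%E.

End operator.

(* Main.v *)
Require Import Defs.
From mathcomp Require Import all_boot all_order all_algebra.
From mathcomp Require Import all_classical all_reals all_analysis.
From mathcomp Require Import measurable_realfun ring lra.

(** Suppose a weight [om] makes P_{s,t} bounded. Near the origin the kernel is
    close to 1, uniformly in the other variable, so P_{s,t} maps the indicator
    of a small box around 0 to a function of modulus at least c (1-|z|^2)^t.
    Hence f = c (1-|z|^2)^t lies in L^p(om dmu_Q), and in L^p(om dmu_q) because
    Q <= q. Then P_{s,t} f must be defined by an absolutely convergent integral
    at some z of the small box, where |K(z,.)| >= 1/2; but the integral of
    (1-|w|^2)^(s+t) diverges when s+t <= -(N+1), as seen on the boxes of size
    d^2 in the normal and d in the tangential directions at (1,0,..,0). *)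

Set Implicit Arguments.
Unset Strict Implicit.
Unset Printing Implicit Defensive.

Import Order.TTheory GRing.Theory Num.Theory.
Import numFieldNormedType.Exports.
Local Open Scope classical_set_scope.
Local Open Scope ring_scope.
Local Open Scope complex_scope.

(** * Monotonicity of the integral without measurability *)

Section nonmeasurable_integral.
Context d (T : measurableType d) (R : realType).
Variable m : {measure set T -> \bar R}.
Local Open Scope ereal_scope.
Import HBNNSimple.

(* [integral] is a supremum over simple functions, hence monotone on all
   nonnegative functions: no measurability is required. *)
Lemma le_nnintegral_ae (f g : T -> \bar R) :
  (forall x, 0 <= f x) -> (forall x, 0 <= g x) ->
  {ae m, forall x, f x <= g x} -> \int[m]_x f x <= \int[m]_x g x.
Proof.
move=> f0 g0 [Z [mZ Z0 fgZ]].
rewrite !ge0_integralTE//.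
apply: ge_ereal_sup => _ [h hf <-].
have mZc : measurable (~` Z) by exact: measurableC.
(* Setting [h] to 0 on the null set [Z] keeps its integral and makes it lie below [g] everywhere. *)
pose h' : {nnsfun T >-> R} := proj_nnsfun h mZc.
have -> : sintegral m h = sintegral m h'.
  rewrite -!integralT_nnsfun.
  apply: ae_eq_integral => //.
  - exact/measurable_EFinP.
  - exact/measurable_EFinP.
  - exists Z; split => // x /= hx; apply: contrapT => nZx; apply: hx => _.
    by rewrite /= mindicE mem_set//= mulr1.
apply: ereal_sup_ubound; exists h' => // x /=.
rewrite mindicE; case: (pselect (Z x)) => Zx.
  by rewrite memNset ?mulr0//=; apply.
rewrite mem_set// mulr1; apply: le_trans (hf x) _.
by apply: contrapT => nfg; apply: Zx; exact: fgZ.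
Qed.

(** Both functions are nonnegative almost everywhere on [D], so the negative parts integrate to 0
    and only the positive parts are compared. This form applies to the modulus of [bergman_op],
    whose measurability is never established. *)
Lemma ae_le_integral (D : set T) (f g : T -> \bar R) :
  {ae m, forall x, D x -> 0 <= f x <= g x} ->
  \int[m]_(x in D) f x <= \int[m]_(x in D) g x.
Proof.
move=> fg; rewrite !(integral_mkcond D) [leLHS]integralE [leRHS]integralE.
have fgD : {ae m, forall x, 0 <= (f \_ D) x <= (g \_ D) x}.
  apply: filterS fg => x; rewrite !patchE; case: ifPn => [/set_mem Dx|_ _].
    exact.
  by rewrite lexx.
have neg0 (h : T -> \bar R) : {ae m, forall x, 0 <= h x} ->
    \int[m]_x h^\- x = 0.
  move=> h0; apply/eqP; rewrite eq_le integral_ge0 ?andbT//.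
  rewrite -[leRHS](integral0 m setT).
  apply: le_nnintegral_ae => //.
  by apply: filterS h0 => x hx; rewrite funenegE ge_max lexx leeNl oppe0 hx.
rewrite neg0; last by apply: filterS fgD => x /andP[].
rewrite neg0; last by apply: filterS fgD => x /andP[+ ?] => /le_trans; apply.
rewrite !sube0; apply: le_nnintegral_ae => //.
apply: filterS fgD => x /andP[f0 fgx]; rewrite !funeposE.
by rewrite max_l// max_l//; exact: le_trans fgx.
Qed.

End nonmeasurable_integral.

(** * Euler's integral and growth of the kernel coefficients *)

Section gamma.
Variable R : realType.
Implicit Types u m x : R.


(** Only the unit interval from [m] to [m + 1] is kept; there the power is smallest at the left end
    and the exponential at the right end. *)
Lemma le_Gamma_integral u m : 1 <= u -> 0 <= m ->
  ((m `^ (u - 1) * expR (- (m + 1)))%:E <=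
   \int[lebesgue_measure]_(x in `]0%R, +oo[) (x `^ (u - 1) * expR (- x))%:E)%E.
Proof.
move=> u1 m0.
apply: (@le_trans _ _ (\int[lebesgue_measure]_(x in `]m, (m + 1)%R[)
  (m `^ (u - 1) * expR (- (m + 1)))%:E)%E).
  rewrite integral_cst//= lebesgue_measure_itv/= lte_fin ltrDl ltr01.
  by rewrite -EFinD addrAC subrr add0r mule1.
apply: (@le_trans _ _ (\int[lebesgue_measure]_(x in `]m, (m + 1)%R[)
  (x `^ (u - 1) * expR (- x))%:E)%E).
  apply: ae_le_integral; apply: aeW => x /=; rewrite in_itv/= => /andP[mx xm].
  rewrite !lee_fin mulr_ge0 ?powR_ge0 ?expR_ge0//=.
  apply: ler_pM; rewrite ?powR_ge0 ?expR_ge0//.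
    by apply: ge0_ler_powR; rewrite ?nnegrE ?subr_ge0// ?(le_trans m0)// ltW.
  by rewrite ler_expR lerN2 ltW.
apply: ge0_subset_integral => //.
- apply/measurable_EFinP; apply: measurable_funM.
    exact: measurable_funTS (measurable_powR _).
  apply: measurable_funTS; exact: (measurableT_comp (@measurable_expR R)).
- by move=> x _; rewrite lee_fin mulr_ge0 ?powR_ge0 ?expR_ge0.
- by apply: subset_itv => //; rewrite bnd_simp.
Qed.

(** This is y <= exp y at y = x / (2u), raised to the power [u]. *)
Lemma powR_le_expR u x : 0 < u -> 0 <= x ->
  x `^ u <= (2 * u) `^ u * expR (x / 2).
Proof.
move=> u0 x0.
have u2 : 0 < 2 * u by rewrite mulr_gt0.
have -> : expR (x / 2) = expR (x / (2 * u)) `^ u.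
  by rewrite -expRM; congr expR; field; rewrite gt_eqF.
have h : x <= 2 * u * expR (x / (2 * u)).
  rewrite -ler_pdivrMl// mulrC; apply: le_trans (expR_ge1Dx _).
  by rewrite lerDr.
rewrite -powRM ?expR_ge0 ?(ltW u2)//.
by apply: ge0_ler_powR; rewrite ?nnegrE ?(ltW u0)// mulr_ge0 ?expR_ge0// ltW.
Qed.

Lemma Gamma_integral_lty u : 1 < u ->
  (\int[lebesgue_measure]_(x in `]0%R, +oo[) (x `^ (u - 1) * expR (- x))%:E
   < +oo)%E.
Proof.
(* Half of the decay of exp(-x) absorbs the power, which leaves an exponential density of rate 1/2;
   the last factor 2 undoes the normalization of that density. *)
move=> u1; set C := (2 * (u - 1)) `^ (u - 1) * 2.
have C0 : 0 <= C by rewrite mulr_ge0 ?powR_ge0.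
apply: (@le_lt_trans _ _ (\int[lebesgue_measure]_x
   (C%:E * (exponential_pdf 2^-1 x)%:E))%E).
  rewrite integral_mkcond; apply: ae_le_integral; apply: aeW => x /= _.
  rewrite patchE; case: ifPn => [/set_mem|_]; last first.
    by rewrite lexx -EFinM lee_fin mulr_ge0// exponential_pdf_ge0.
  rewrite /= in_itv/= andbT => x0.
  rewrite -EFinM !lee_fin mulr_ge0 ?powR_ge0 ?expR_ge0//=.
  rewrite exponential_pdfE ?(ltW x0)// /C.
  have := @powR_le_expR (u - 1) x; rewrite subr_gt0 => /(_ u1 (ltW x0)) h.
  apply: (le_trans (ler_wpM2r (expR_ge0 (- x)) h)).
  have -> : expR (- 2^-1 * x) = expR (x / 2) * expR (- x).
    by rewrite -expRD; congr expR; field.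
  by rewrite le_eqVlt; apply/orP; left; apply/eqP; field.
rewrite ge0_integralZl_EFin//.
- by rewrite integral_exponential_pdf// mule1 ltry.
- by move=> x _; rewrite lee_fin exponential_pdf_ge0.
- by apply/measurable_EFinP; exact: measurable_exponential_pdf.
Qed.

Lemma Gamma_gt0 u : 1 < u -> 0 < Gamma u.
Proof.
move=> u1; rewrite /Gamma /Rintegral fine_gt0// Gamma_integral_lty// andbT.
apply: lt_le_trans (@le_Gamma_integral u 1 (ltW u1) ler01).
by rewrite lte_fin mulr_gt0 ?powR_gt0 ?expR_gt0.
Qed.

Lemma fact_leq_exp n : (n`! <= n ^ n)%N.
Proof.
case: n => // n; rewrite fact_prod big_add1 /= big_mkord.
rewrite -[X in (_ <= _ ^ X)%N]card_ord -prod_nat_const.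
by apply: leq_prod => i _.
Qed.

Lemma Gamma_coef_ge0 u k : 1 < u -> 0 <= k`!%:R / pochhammer u k.
Proof.
move=> u1; rewrite divr_ge0// /pochhammer divr_ge0//; last exact/ltW/Gamma_gt0.
by apply/ltW/Gamma_gt0; rewrite ltr_wpDr.
Qed.

Lemma Gamma_coef0 u : 1 < u -> 0`!%:R / pochhammer u 0 = 1.
Proof.
move=> u1; rewrite /pochhammer addr0 divff ?gt_eqF ?Gamma_gt0//.
by rewrite divr1.
Qed.

(** Taking m = k in the lower bound for Euler's integral reduces the claim to k! <= k^k <=
    k^(u+k-1), where the last inequality uses k >= 1. This crude exponential bound suffices because
    the kernel is only estimated for small inner products. *)
Lemma Gamma_coef_le u k : 1 < u -> (0 < k)%N ->
  k`!%:R / pochhammer u k <= Gamma u * expR 1 ^+ k.+1.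
Proof.
move=> u1 k0; have uk1 : 1 < u + k%:R by rewrite ltr_wpDr.
have G0 := Gamma_gt0 uk1; have G0' := Gamma_gt0 u1.
rewrite /pochhammer invf_div mulrCA ler_pM2l// ler_pdivrMr//.
have h : k%:R `^ (u + k%:R - 1) * expR (- (k%:R + 1)) <= Gamma (u + k%:R).
  rewrite -lee_fin fineK; first by apply: le_Gamma_integral => //; exact: ltW.
  by rewrite ge0_fin_numE ?Gamma_integral_lty//; apply: integral_ge0 => x _;
    rewrite lee_fin mulr_ge0 ?powR_ge0 ?expR_ge0.
have -> : expR 1 ^+ k.+1 = (expR (- (k%:R + 1)))^-1 :> R.
  by rewrite expRN invrK natr1 -expRM_natl mulr1.
rewrite mulrC -ler_pdivrMr ?invr_gt0 ?expR_gt0// invrK.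
apply: le_trans h; rewrite ler_pM2r ?expR_gt0//.
apply: (@le_trans _ _ (k%:R ^+ k)).
  by rewrite -natrX ler_nat fact_leq_exp.
rewrite -powR_mulrn//; apply: ler_powR; first by rewrite ler1n.
by rewrite addrAC lerDr subr_ge0 ltW.
Qed.

End gamma.

(** * Complex moduli and power series with geometrically bounded coefficients *)

Section complex_series.
Variable R : realType.
Implicit Types (z : R[i]) (c : R^nat).

Lemma normc_ge0 z : 0 <= Normc.normc z.
Proof. by case: z => a b; rewrite sqrtr_ge0. Qed.

Lemma normc_sqr z : Normc.normc z ^+ 2 = complex.Re z ^+ 2 + complex.Im z ^+ 2.
Proof. by case: z => a b /=; rewrite sqr_sqrtr// addr_ge0// sqr_ge0. Qed.

Lemma normc_ge_Re z : `|complex.Re z| <= Normc.normc z.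
Proof.
case: z => a b /=; rewrite -sqrtr_sqr ler_sqrt ?lerDl ?sqr_ge0//.
by rewrite addr_ge0// sqr_ge0.
Qed.

Lemma normc_ge_Im z : `|complex.Im z| <= Normc.normc z.
Proof.
case: z => a b /=; rewrite -sqrtr_sqr ler_sqrt ?lerDr ?sqr_ge0//.
by rewrite addr_ge0// sqr_ge0.
Qed.

Lemma normc_le_ReIm z : Normc.normc z <= `|complex.Re z| + `|complex.Im z|.
Proof.
rewrite -(ler_pXn2r (n:=2)) ?nnegrE ?normc_ge0 ?addr_ge0//.
rewrite normc_sqr sqrrD !real_normK ?num_real// lerD2r lerDl.
by rewrite mulrn_wge0// mulr_ge0.
Qed.

Lemma normcX z n : Normc.normc (z ^+ n) = Normc.normc z ^+ n.
Proof.
elim: n => [|n IH]; first by rewrite !expr0 Normc.normc1.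
by rewrite !exprS Normc.normcM IH.
Qed.

Lemma normc_sum (I : Type) (s : seq I) (F : I -> R[i]) :
  Normc.normc (\sum_(i <- s) F i) <= \sum_(i <- s) Normc.normc (F i).
Proof.
elim: s => [|i s IH]; first by rewrite !big_nil Normc.normc0.
by rewrite !big_cons; apply: le_trans (le_normcD _ _) _; rewrite lerD2l.
Qed.

Lemma cvg_complex (T : Type) (F : set_system T) {FF : Filter F}
    (u : T -> R[i]) (a b : R) :
  complex.Re (u x) @[x --> F] --> a -> complex.Im (u x) @[x --> F] --> b ->
  (u x : R[i]^o) @[x --> F] --> (a +i* b : R[i]^o).
Proof.
move=> ua ub; apply/cvgrPdist_lt => -[e e'].
(* The radius is itself a complex number; its positivity forces the imaginary part to be 0. *)
rewrite ltcE/= => /andP[/eqP -> e0].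
have e20 : 0 < e / 2 by rewrite divr_gt0.
near=> x.
rewrite /Num.norm/= ltcR.
apply: le_lt_trans (normc_le_ReIm _) _ => /=.
rewrite [ltRHS](splitr e) ltrD//.
- near: x; move/cvgrPdist_lt : ua => /(_ _ e20) h.
  by apply: filterS h => x; case: (u x).
- near: x; move/cvgrPdist_lt : ub => /(_ _ e20) h.
  by apply: filterS h => x; case: (u x).
Unshelve. all: by end_near. Qed.

(** Induction on S(n+1) = x + x S(n), which is at most x + (1/2)(2x). *)
Lemma geometric_sum_le (x : R) n : 0 <= x -> x <= 2^-1 ->
  \sum_(0 <= k < n) x ^+ k.+1 <= 2 * x.
Proof.
move=> x0 x2; elim: n => [|n IH]; first by rewrite big_geq// mulr_ge0.
rewrite big_nat_recl// expr1.
under eq_bigr do rewrite exprS.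
rewrite -mulr_sumr.
have : x * \sum_(0 <= i < n) x ^+ i.+1 <= 2^-1 * (2 * x).
  by rewrite ler_pM// sumr_ge0// => i _; rewrite exprn_ge0.
lra.
Qed.

Variables (c : R^nat) (A B rho : R) (z : R[i]).
Hypotheses (c01 : c 0%N = 1) (c_ge0 : forall k, 0 <= c k).
Hypothesis c_le : forall k, (0 < k)%N -> c k <= A * B ^+ k.
Hypotheses (A0 : 0 <= A) (B0 : 0 <= B) (rho0 : 0 <= rho).
Hypotheses (zrho : Normc.normc z <= rho) (Brho : B * rho <= 2^-1).

Let u n : R[i] := \sum_(0 <= k < n) (c k)%:C * z ^+ k.

Let term_le k : (0 < k)%N ->
  Normc.normc ((c k)%:C * z ^+ k) <= A * (B * rho) ^+ k.
Proof.
move=> k0; rewrite Normc.normcM normcX /= expr0n/= addr0 sqrtr_sqr ger0_norm//.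
rewrite exprMn mulrA ler_pM ?exprn_ge0 ?normc_ge0 ?c_le//.
by rewrite ler_pXn2r ?nnegrE ?normc_ge0.
Qed.

(** Real and imaginary parts are treated at once, as additive maps dominated by the modulus. The
    comparison series has the constant [1 + A] so as to cover the term k = 0, to which [c_le] does
    not apply. *)
Let cvg_part (h : R[i] -> R) : h 0 = 0 -> {morph h : x y / x + y} ->
  (forall w, `|h w| <= Normc.normc w) -> cvgn (fun n => h (u n)).
Proof.
move=> h0 hD hle.
have -> : (fun n => h (u n)) = series (fun k => h ((c k)%:C * z ^+ k)).
  by apply/funext => n; rewrite /u (big_morph h hD h0).
have Brho1 : `|B * rho| < 1.
  by rewrite ger0_norm ?mulr_ge0//; apply: le_lt_trans Brho _; lra.
apply: normed_cvg.
apply: (@series_le_cvg _ _ (geometric (1 + A) (B * rho))) => //.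
- by move=> k /=.
- by move=> k /=; apply: mulr_ge0; [exact: addr_ge0|exact/exprn_ge0/mulr_ge0].
- move=> k /=; apply: le_trans (hle _) _.
  have [->|k0] := posnP k.
    by rewrite c01 !expr0 mulr1 Normc.normc1 mulr1 lerDl.
  apply: le_trans (term_le k0) _; rewrite ler_wpM2r ?lerDr//.
  by rewrite exprn_ge0// mulr_ge0.
- exact: is_cvg_geometric_series.
Qed.

Let cvg_Re : cvgn (fun n => complex.Re (u n)).
Proof.
by apply: cvg_part => //; [case=> ? ? [] | exact: normc_ge_Re].
Qed.

Let cvg_Im : cvgn (fun n => complex.Im (u n)).
Proof.
by apply: cvg_part => //; [case=> ? ? [] | exact: normc_ge_Im].
Qed.

Lemma Re_lim_power_series :
  complex.Re (limn (u : nat -> R[i]^o)) = limn (fun n => complex.Re (u n)).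
Proof.
have h : (u : nat -> R[i]^o) @ \oo -->
    (limn (fun n => complex.Re (u n)) +i*
     limn (fun n => complex.Im (u n)) : R[i]^o).
  by apply: cvg_complex; [exact: cvg_Re | exact: cvg_Im].
by rewrite (cvg_lim (@norm_hausdorff _ _) h).
Qed.

(** The constant term is 1, and the moduli of the others are dominated by a geometric series of
    ratio [B * rho <= 2^-1]. *)
Lemma Re_power_series_dist :
  `|complex.Re (limn (u : nat -> R[i]^o)) - 1| <= 2 * A * (B * rho).
Proof.
rewrite Re_lim_power_series.
have h : (fun n => `|complex.Re (u n) - 1|) @ \oo -->
    `|limn (fun n => complex.Re (u n)) - 1|.
  by apply: cvg_norm; apply: cvgB; [exact: cvg_Re | exact: cvg_cst].
rewrite -(cvg_lim (@norm_hausdorff _ _) h).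
apply: limr_le; first by apply/cvg_ex; eexists; exact: h.
(* The empty partial sum lacks the constant term 1, so the bound is claimed from index 1 on. *)
exists 1%N => // -[//|n] _ /=.
have -> : complex.Re (u n.+1) - 1 = complex.Re (u n.+1 - 1).
  by case: (u n.+1).
apply: le_trans (normc_ge_Re _) _.
rewrite /u big_nat_recl// c01 expr0 mulr1 addrAC subrr add0r.
apply: le_trans (normc_sum _ _) _.
apply: (@le_trans _ _ (\sum_(0 <= k < n) A * (B * rho) ^+ k.+1)).
  by apply: ler_sum => k _; exact: term_le.
rewrite -mulr_sumr -mulrA mulrCA ler_wpM2l//.
by apply: geometric_sum_le => //; rewrite mulr_ge0.
Qed.

End complex_series.

(** * Measurability and volume of boxes in complex coordinates *)

Section boxes.
Variable R : realType.
Local Notation lebesgue := (@lebesgue_measure R).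
Implicit Types X Y : nat -> set (measurableTypeR R).

(** The sides are indexed by [nat] rather than ['I_n], so that removing the first coordinate is the
    shift [X \o S] in inductions on [n]. *)
Definition cbox X Y n : set (n.-tuple R[i]) :=
  [set z | forall j : 'I_n,
    X j (complex.Re (tnth z j)) /\ Y j (complex.Im (tnth z j))].
Arguments cbox X Y n _ : clear implicits.

Lemma measurable_Re : measurable_fun [set: R[i]] (@complex.Re R).
Proof.
exact: (measurableT_comp (@measurable_fst _ _ _ _)
  (@measurable_complex_to_pair R)).
Qed.

Lemma measurable_Im : measurable_fun [set: R[i]] (@complex.Im R).
Proof.
exact: (measurableT_comp (@measurable_snd _ _ _ _)
  (@measurable_complex_to_pair R)).
Qed.

Lemma measurable_rect (A B : set (measurableTypeR R)) :
  measurable A -> measurable B ->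
  measurable [set z : R[i] | A (complex.Re z) /\ B (complex.Im z)].
Proof.
move=> mA mB; apply: measurableI.
  by rewrite -[X in measurable X]setTI; exact: measurable_Re.
by rewrite -[X in measurable X]setTI; exact: measurable_Im.
Qed.

Lemma lebesgueC_rect (A B : set (measurableTypeR R)) :
  measurable A -> measurable B ->
  lebesgueC R [set z | A (complex.Re z) /\ B (complex.Im z)] =
  (lebesgue A * lebesgue B)%E.
Proof. by move=> mA mB; rewrite -product_measure1E. Qed.

Lemma measurable_cbox X Y n : (forall j, measurable (X j)) ->
  (forall j, measurable (Y j)) -> measurable (cbox X Y n).
Proof.
move=> mX mY.
have -> : cbox X Y n = \bigcap_(j in [set: 'I_n])
    ((fun z => tnth z j) @^-1`
       [set z | X j (complex.Re z) /\ Y j (complex.Im z)]).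
  by apply/seteqP; split => z /= h j; [move=> _; exact: h | exact: h].
apply: fin_bigcap_measurable; first exact: finite_finset.
move=> j _; rewrite -[X in measurable X]setTI.
exact: measurable_tnth (measurable_rect (mX j) (mY j)).
Qed.

Lemma lebesgueCn_cbox X Y n : (forall j, measurable (X j)) ->
  (forall j, measurable (Y j)) ->
  lebesgueCn R n (cbox X Y n) =
  (\prod_(j < n) (lebesgue (X j) * lebesgue (Y j)))%E.
Proof.
elim: n X Y => [|n IH] X Y mX mY.
  rewrite big_ord0 /= diracE mem_set// => -[] //.
rewrite big_ord_recl -lebesgueC_rect//.
rewrite -(IH (X \o S) (Y \o S))//; last 2 first.
- by move=> j; exact: mX.
- by move=> j; exact: mY.
rewrite -product_measure1E//; last 2 first.
- exact: measurable_rect.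
- by apply: measurable_cbox => j; [exact: mX | exact: mY].
rewrite /= /pushforward; congr (_ _).
apply/seteqP; split => -[z u] /=.
  move=> h; split; first by have := h ord0; rewrite (tnth_nth 0).
  by move=> j /=; have := h (lift ord0 j); rewrite tnthS.
move=> [h0 h] j; have [k ->|->] := unliftP ord0 j; last by rewrite tnth0.
by rewrite tnthS; exact: h.
Qed.

Lemma lebesgueCn_cbox_itv (a b c d : nat -> R) n :
  (forall j, a j <= b j) -> (forall j, c j <= d j) ->
  lebesgueCn R n
    (cbox (fun j => `[a j, b j]%classic) (fun j => `[c j, d j]%classic) n) =
  (\prod_(j < n) ((b j - a j) * (d j - c j)))%:E.
Proof.
have lE (x y : R) : x <= y -> lebesgue `[x, y]%classic = (y - x)%:E.
  rewrite lebesgue_measure_itv/= lte_fin le_eqVlt => /predU1P[->|->//].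
  by rewrite ltxx subrr.
move=> ab cd; rewrite lebesgueCn_cbox// -prodEFin.
by apply: eq_bigr => j _; rewrite EFinM -!lE.
Qed.

End boxes.
Arguments cbox {R} X Y n _.

Lemma le_integral_of_cst d (T : measurableType d) (R : realType)
    (m : {measure set T -> \bar R}) (A D : set T) (k : R) (f : T -> \bar R) :
  measurable A -> A `<=` D -> 0 <= k -> (forall x, A x -> (k%:E <= f x)%E) ->
  (forall x, D x -> (0 <= f x)%E) -> (k%:E * m A <= \int[m]_(x in D) f x)%E.
Proof.
move=> mA AD k0 kf f0; rewrite -(integral_cst m mA).
rewrite integral_mkcond [leRHS]integral_mkcond.
apply: ae_le_integral; apply: aeW => x _; rewrite !patchE.
case: ifPn => [/set_mem Ax|_].
  by rewrite mem_set ?lee_fin ?k0 ?kf//; exact: AD.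
by rewrite lexx/=; case: ifPn => // /set_mem; exact: f0.
Qed.

(** * The unit ball, its weight function and its volume *)

Section ball.
Variables (R : realType) (N : nat).
Local Notation lebesgue := (@lebesgue_measure R).
Local Notation B := (unit_ball R N).
Implicit Types z w : N.-tuple R[i].

Lemma enorm_ge0 z : 0 <= enorm z. Proof. exact: sqrtr_ge0. Qed.

Lemma enorm_sqr z :
  enorm z ^+ 2 = \sum_(j < N) Normc.normc (tnth z j) ^+ 2.
Proof.
have -> : \sum_(j < N) Normc.normc (tnth z j) ^+ 2 = complex.Re (inner z z).
  rewrite /inner (big_morph (@complex.Re R) (id1 := 0) (op1 := +%R))//.
    apply: eq_bigr => j _; rewrite normc_sqr; case: (tnth z j) => a b /=.
    by rewrite mulrN opprK !expr2.
  by case=> ? ? [].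
rewrite sqr_sqrtr//.
rewrite /inner (big_morph (@complex.Re R) (id1 := 0) (op1 := +%R))//;
  last first.
  by case=> ? ? [].
apply: sumr_ge0 => j _; case: (tnth z j) => a b /=.
by rewrite mulrN opprK addr_ge0// -expr2 sqr_ge0.
Qed.

Lemma normc_tnth_le z j : Normc.normc (tnth z j) <= enorm z.
Proof.
rewrite -(ler_pXn2r (n:=2)) ?nnegrE ?normc_ge0 ?enorm_ge0//.
rewrite enorm_sqr (bigD1 j)//= lerDl sumr_ge0// => k _.
by rewrite exprn_ge0// normc_ge0.
Qed.

Lemma normc_inner_le z w a b : 0 <= a -> 0 <= b ->
  (forall j, Normc.normc (tnth z j) <= a) ->
  (forall j, Normc.normc (tnth w j) <= b) ->
  Normc.normc (inner z w) <= N%:R * (a * b).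
Proof.
move=> a0 b0 za wb; apply: le_trans (normc_sum _ _) _.
apply: (@le_trans _ _ (\sum_(j < N) a * b)).
  apply: ler_sum => j _; rewrite Normc.normcM ler_pM ?normc_ge0//.
  by apply: le_trans (wb j); case: (tnth w j) => x y /=; rewrite sqrrN.
by rewrite sumr_const card_ord mulr_natl.
Qed.

Lemma ball_weight_gt0 z : B z -> 0 < 1 - enorm z ^+ 2.
Proof. by move=> Bz; rewrite subr_gt0 expr_lt1 ?enorm_ge0. Qed.

Lemma ball_weight_le1 z : 1 - enorm z ^+ 2 <= 1.
Proof. by rewrite gerBl exprn_ge0 ?enorm_ge0. Qed.

Lemma ballP z : 0 < 1 - enorm z ^+ 2 -> B z.
Proof. by rewrite subr_gt0 expr_lt1 ?enorm_ge0. Qed.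

Lemma measurable_weight : measurable_fun setT (fun z => 1 - enorm z ^+ 2 : R).
Proof.
have -> : (fun z => 1 - enorm z ^+ 2 : R) =
    (fun z => 1 - \sum_(j < N) (complex.Re (tnth z j) ^+ 2 +
                                complex.Im (tnth z j) ^+ 2)).
  by apply/funext => z; rewrite enorm_sqr; congr (1 - _);
    apply: eq_bigr => j _; rewrite normc_sqr.
apply: measurable_funB => //; apply: measurable_sum => j.
apply: measurable_funD; apply: measurable_funX.
  exact: (measurableT_comp (@measurable_Re R) (measurable_tnth j)).
exact: (measurableT_comp (@measurable_Im R) (measurable_tnth j)).
Qed.

Lemma measurable_unit_ball : measurable B.
Proof.
have -> : B = (fun z => 1 - enorm z ^+ 2 : R) @^-1` `]0, +oo[.
  apply/seteqP; split => z /=; rewrite in_itv/= andbT.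
    exact: ball_weight_gt0.
  exact: ballP.
by rewrite -[X in measurable X]setTI; exact: measurable_weight.
Qed.

(** A box with a corner at 0 serves as a neighbourhood of the origin: its volume is an explicit
    product, and positive measure and compactness are what matters. *)
Definition small_box (r : R) : set (N.-tuple R[i]) :=
  cbox (fun=> `[0, r]%classic) (fun=> `[0, r]%classic) N.

Lemma normc_small_box r z j : small_box r z -> Normc.normc (tnth z j) <= 2 * r.
Proof.
move=> /(_ j) /=; rewrite !in_itv/= => -[/andP[x0 xr] /andP[y0 yr]].
apply: le_trans (normc_le_ReIm _) _; rewrite !ger0_norm//.
by rewrite mulr_natl mulr2n lerD.
Qed.

Lemma measurable_small_box r : measurable (small_box r).
Proof. by apply: measurable_cbox. Qed.

Lemma small_box_volume r : 0 <= r ->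
  lebesgueCn R N (small_box r) = ((r ^+ 2) ^+ N)%:E.
Proof.
move=> r0; rewrite lebesgueCn_cbox_itv// prodr_const card_ord.
by rewrite subr0 -expr2.
Qed.


Lemma small_box_weight r z : small_box r z ->
  1 - N%:R * (2 * r) ^+ 2 <= 1 - enorm z ^+ 2.
Proof.
move=> zr; rewrite lerD2l lerN2 enorm_sqr.
apply: (@le_trans _ _ (\sum_(j < N) (2 * r) ^+ 2)).
  apply: ler_sum => j _.
  have h := normc_small_box j zr.
  by rewrite ler_pXn2r ?nnegrE ?normc_ge0// (le_trans _ h) ?normc_ge0.
by rewrite sumr_const card_ord [leRHS]mulr_natl.
Qed.

Lemma small_box_ball r z : N%:R * (2 * r) ^+ 2 < 1 -> small_box r z -> B z.
Proof.
move=> Nr /small_box_weight zr; apply: ballP; apply: lt_le_trans zr.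
by rewrite subr_gt0.
Qed.

Lemma ball_volume_lty : (lebesgueCn R N B < +oo)%E.
Proof.
pose C : set (N.-tuple R[i]) :=
  cbox (fun=> `[-1, 1]%classic) (fun=> `[-1, 1]%classic) N.
apply: (@le_lt_trans _ _ (lebesgueCn R N C)); last first.
  by rewrite lebesgueCn_cbox_itv ?ltry// => j; lra.
apply: le_measure; rewrite ?inE.
- exact: measurable_unit_ball.
- exact: measurable_cbox.
- move=> z Bz j; have z1 := le_trans (normc_tnth_le z j) (ltW Bz).
  by rewrite /= !in_itv/= -!ler_norml; split; apply: le_trans z1;
    [exact: normc_ge_Re | exact: normc_ge_Im].
Qed.

Lemma ball_volume_gt0 : (0 < lebesgueCn R N B)%E.
Proof.
(* With 2r = x = 1/(N+1) one has N x^2 = (1 - x) x < 1, so the box lies in the ball. *)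
pose x : R := N.+1%:R^-1; pose r := x / 2.
have x0 : 0 < x by rewrite invr_gt0.
have r0 : 0 < r by rewrite divr_gt0.
have Nr : N%:R * (2 * r) ^+ 2 < 1.
  have -> : 2 * r = x by rewrite /r; field.
  have Nx : N%:R * x + x = 1 by rewrite -{2}(mul1r x) -mulrDl natr1 divff.
  have : 0 <= N%:R * x by rewrite mulr_ge0// ltW.
  nra.
apply: (@lt_le_trans _ _ (lebesgueCn R N (small_box r))).
  by rewrite small_box_volume ?lte_fin ?ltW// !exprn_gt0.
apply: le_measure; rewrite ?inE.
- exact: measurable_small_box.
- exact: measurable_unit_ball.
- by move=> z; exact: small_box_ball Nr.
Qed.

Lemma muE (A : set (N.-tuple R[i])) :
  mu R N A = (((fine (lebesgueCn R N B))^-1)%:E * lebesgueCn R N A)%E.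
Proof. by []. Qed.

(** A volume 0 or [+oo] would make this factor 0 through the default values of [fine] and of the
    inverse, and [mu] would vanish; both bounds on the volume are therefore used. *)
Lemma mu_scale_gt0 : 0 < (fine (lebesgueCn R N B))^-1.
Proof. by rewrite invr_gt0 fine_gt0// ball_volume_gt0 ball_volume_lty. Qed.

Lemma mu_ball_lty : (mu R N B < +oo)%E.
Proof.
by rewrite muE lte_mul_pinfty ?lee_fin ?ltW ?mu_scale_gt0 ?ball_volume_lty.
Qed.

Lemma mu_small_box_gt0 r : 0 < r -> (0 < mu R N (small_box r))%E.
Proof.
move=> r0; rewrite muE small_box_volume ?ltW//.
by rewrite -EFinM lte_fin mulr_gt0 ?mu_scale_gt0 ?exprn_gt0.
Qed.

End ball.

(** * Divergence of the integral of a power of 1 - |w|^2 near the boundary *)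

Section divergence.
Variables (R : realType) (n : nat).
Local Notation N := n.+1.
Local Notation B := (unit_ball R N).
Variable d : R.
Hypotheses (d0 : 0 < d) (d1 : 2 * (2 * N%:R * d ^+ 2) <= 1).

(** The factor 2N makes [h] larger than (2n+1) d^2, the most that all coordinates other than the
    real part of the first add to |z|^2. Hence |z|^2 < (1 - h)^2 + h < 1 on the box. *)
Let h : R := 2 * N%:R * d ^+ 2.

Let h0 : 0 < h. Proof. by rewrite !mulr_gt0 ?exprn_gt0. Qed.

Let a j : R := if j == 0%N then 1 - 2 * h else 0.
Let b j : R := if j == 0%N then 1 - h else d.

(* Box of size [d ^+ 2] in the normal direction at (1, 0, .., 0) and of size [d]
   in the tangential ones. *)
Definition boundary_box : set (N.-tuple R[i]) :=
  cbox (fun j => `[a j, b j]%classic) (fun=> `[0, d]%classic) N.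

Lemma measurable_boundary_box : measurable boundary_box.
Proof. by apply: measurable_cbox. Qed.

Lemma boundary_box_volume :
  lebesgueCn R N boundary_box = (h * d * (d ^+ 2) ^+ n)%:E.
Proof.
rewrite lebesgueCn_cbox_itv; last 2 first.
- move=> j; rewrite /a /b; case: ifP => _; [move: h0; lra|exact: ltW].
- by move=> _; exact: ltW.
rewrite big_ord_recl (eq_bigr (fun=> d ^+ 2)) ?prodr_const ?card_ord//=.
  by congr (_ * _)%:E; rewrite /a /b/= subr0; congr (_ * _); ring.
by move=> j _; rewrite /a /b/= !subr0 expr2.
Qed.

Lemma boundary_box_weight z : boundary_box z ->
  0 < 1 - enorm z ^+ 2 <= 4 * h.
Proof.
have h2 : 2 * h <= 1 := d1.
move=> zb; apply/andP; split; last first.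
  have [/= + _] := zb ord0; rewrite in_itv/= /a /b/= => /andP[x0 _].
  have : (1 - 2 * h) ^+ 2 <= enorm z ^+ 2.
    rewrite ler_pXn2r ?nnegrE ?enorm_ge0 ?subr_ge0//.
    apply: le_trans (normc_tnth_le z ord0).
    by apply: le_trans x0 (le_trans (ler_norm _) (normc_ge_Re _)).
  have : 0 <= h ^+ 2 by rewrite sqr_ge0.
  nra.
rewrite subr_gt0 enorm_sqr big_ord_recl.
have z0 : Normc.normc (tnth z ord0) ^+ 2 <= (1 - h) ^+ 2 + d ^+ 2.
  have [/=] := zb ord0; rewrite !in_itv/= /a /b/= => /andP[x0 x1] /andP[y0 y1].
  rewrite normc_sqr lerD// ler_pXn2r ?nnegrE//; have := h0; lra.
have zS : \sum_(i < n) Normc.normc (tnth z (lift ord0 i)) ^+ 2 <=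
    n%:R * (2 * d ^+ 2).
  rewrite mulr_natl -[n in _ *+ n]card_ord -sumr_const; apply: ler_sum => i _.
  have [/=] := zb (lift ord0 i).
  rewrite !in_itv/= /a /b/= => /andP[x0 x1] /andP[y0 y1].
  by rewrite normc_sqr mulr_natl mulr2n lerD// ler_pXn2r ?nnegrE ?(ltW d0).
have : d ^+ 2 > 0 by rewrite exprn_gt0.
have : (1 - h) ^+ 2 + h < 1 by have := h0; nra.
move: z0 zS; rewrite /h -natr1; nra.
Qed.

End divergence.

(** With N = n+1, the integrand on the box of parameter d is at least a constant times d^(-2N-2),
    while the volume is of order d^(2N+1). Every small d thus bounds the integral below by a fixed
    multiple of 1/d. *)
Lemma power_integral_diverges (R : realType) (n : nat) (sigma : R) :
  sigma <= - n.+2%:R ->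
  (\int[mu R n.+1]_(w in unit_ball R n.+1)
     ((1 - enorm w ^+ 2) `^ sigma)%:E = +oo)%E.
Proof.
move=> hsigma; apply/eqP; rewrite -leye_eq leNgt; apply/negP.
set I := integral _ _ _ => Ioo.
have I0 : (0 <= I)%E by apply: integral_ge0 => w _; rewrite lee_fin powR_ge0.
pose kappa : R := (fine (lebesgueCn R n.+1 (unit_ball R n.+1)))^-1.
have kappa0 : 0 < kappa by exact: mu_scale_gt0.
pose c : R := 2 * n.+1%:R.
have c0 : 0 < c by rewrite mulr_gt0.
have c1 : 1 <= c.
  by rewrite /c -natr1; have : 0 <= n%:R :> R by []; lra.
(* The box contribution exceeds [fine I] as soon as X d < 1. Taking d = 1/(4c + X) ensures this and
   also 4 c d^2 <= 1. *)
pose X := fine I * (4 * c) ^+ n.+2 / (kappa * c).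
have X0 : 0 <= X.
  apply: divr_ge0; last by apply/ltW; rewrite mulr_gt0.
  by apply: mulr_ge0; [exact: fine_ge0|apply: exprn_ge0; lra].
pose d := (4 * c + X)^-1.
have d0 : 0 < d by rewrite invr_gt0; lra.
have dE : 4 * c * d + X * d = 1 by rewrite -mulrDl divff// gt_eqF//; lra.
have Xd0 : 0 <= X * d by rewrite mulr_ge0// ltW.
have cd0 : 0 < c * d by rewrite mulr_gt0.
have d1 : d <= 1 by nra.
have h4 : 4 * (c * d ^+ 2) <= 1 by nra.
have h0 : 0 < c * d ^+ 2 by rewrite mulr_gt0// exprn_gt0.
have d1' : 2 * (2 * n.+1%:R * d ^+ 2) <= 1 by move: h4; rewrite /c; lra.
have : ((4 * (c * d ^+ 2)) `^ sigma * (kappa * (c * d ^+ 2 * d * (d ^+ 2) ^+ n))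
    <= fine I).
  rewrite -lee_fin fineK ?ge0_fin_numE// EFinM EFinM -boundary_box_volume//.
  rewrite -muE; apply: le_integral_of_cst => //.
  - exact: measurable_boundary_box.
  - by move=> z /(boundary_box_weight d0 d1') /andP[+ _]; exact: ballP.
  - by rewrite powR_ge0.
  - move=> z /(boundary_box_weight d0 d1') /andP[w0 w1]; rewrite lee_fin.
    have s0 : 0 <= - sigma by have : 0 <= n.+2%:R :> R by []; lra.
    rewrite -[sigma]opprK powRN [leRHS]powRN lef_pV2 ?posrE ?powR_gt0//;
      last first.
      by move: h0; lra.
    by apply: ge0_ler_powR; rewrite ?nnegrE// ltW//; move: h0; lra.
  - by move=> z _; rewrite lee_fin powR_ge0.
apply/negP; rewrite -ltNge.
(* The base is at most 1, so the real exponent [sigma] may be raised to the integer -(n+2). *)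
have : (4 * (c * d ^+ 2)) `^ (- n.+2%:R) <= (4 * (c * d ^+ 2)) `^ sigma.
  by apply: ger_powR => //; rewrite h4 andbT; move: h0; lra.
rewrite powR_invn; last by move: h0; lra.
set P := _ `^ sigma => hP.
set V := kappa * _.
have V0 : 0 < V by rewrite !mulr_gt0// !exprn_gt0.
apply: lt_le_trans (ler_wpM2r (ltW V0) hP).
rewrite mulrC ltr_pdivlMr ?exprn_gt0//; last by move: h0; lra.
have -> : (4 * (c * d ^+ 2)) ^+ n.+2 =
    (4 * c) ^+ n.+2 * (d ^+ 2) ^+ 2 * (d ^+ 2) ^+ n.
  by rewrite mulrA exprMn -[RHS]mulrA -exprD.
have -> : fine I * ((4 * c) ^+ n.+2 * (d ^+ 2) ^+ 2 * (d ^+ 2) ^+ n) =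
    (X * d) * (kappa * c * d ^+ 3 * (d ^+ 2) ^+ n).
  rewrite /X; set e := _ ^+ n.+2; set e' := _ ^+ n; field.
  by rewrite !gt_eqF.
have -> : V = kappa * c * d ^+ 3 * (d ^+ 2) ^+ n by rewrite /V; ring.
rewrite gtr_pMl; first by lra.
by rewrite !mulr_gt0// !exprn_gt0.
Qed.

(** * Compactness of the small box and the kernel near the origin *)

Section small_box.
Variables (R : realType) (N : nat).
Local Notation B := (unit_ball R N).
Implicit Types z w : N.-tuple R[i].

Lemma compact_complex_rect (a b c d : R) :
  compact [set z : R[i]^o |
    complex.Re z \in `[a, b] /\ complex.Im z \in `[c, d]].
Proof.
have -> : [set z : R[i]^o |
      complex.Re z \in `[a, b] /\ complex.Im z \in `[c, d]]
    = (fun u : R * R => u.1 +i* u.2 : R[i]^o) @` (`[a, b] `*` `[c, d]).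
  apply/seteqP; split => [[x y] /= [xab ycd]|_ [[x y] [/= xab ycd] <-]//].
  by exists (x, y).
apply: continuous_compact.
  apply: continuous_subspaceT => u; 
  apply: (@cvg_complex R _ (nbhs u) _ (fun u => u.1 +i* u.2) u.1 u.2).
    exact: cvg_fst.
  exact: cvg_snd.
by apply: compact_setX; exact: segment_compact.
Qed.

Lemma compact_small_box r : compact (@to_rV R N @` small_box r).
Proof.
have -> : @to_rV R N @` small_box r =
    [set v : 'rV[R[i]^o]_N | forall j, [set z : R[i]^o |
      complex.Re z \in `[0, r] /\ complex.Im z \in `[0, r]] (v ord0 j)].
  apply/seteqP; split => [_ [z zr <-] j|v h].
    by rewrite mxE; exact: zr.
  exists [tuple v ord0 j | j < N].
    by move=> j; rewrite tnth_mktuple; exact: h.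
  by apply/rowP => j; rewrite mxE tnth_mktuple.
apply: (@rV_compact R[i]^o N (fun=> [set z : R[i]^o |
  complex.Re z \in `[0, r] /\ complex.Im z \in `[0, r]])) => j.
exact: compact_complex_rect.
Qed.

Lemma bergman_kernel_near1 (a : R) : a < - N%:R ->
  exists2 rho : R, 0 < rho & forall z w, Normc.normc (inner z w) <= rho ->
    2^-1 <= complex.Re (bergman_kernel a z w) <= 3 / 2.
Proof.
move=> aN; pose u : R := 1 - N%:R - a.
have u1 : 1 < u by rewrite /u; lra.
have G0 := Gamma_gt0 u1.
pose e : R := expR 1; have e0 : 0 < e by exact: expR_gt0.
pose A := Gamma u * e; have A0 : 0 < A by rewrite mulr_gt0.
(* This makes both e rho and 2 A e rho at most 1/2: the first gives convergence, the second keeps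
   the kernel within 1/2 of 1. *)
pose rho := (e * (2 + 4 * A))^-1.
have rho0 : 0 < rho by rewrite invr_gt0 mulr_gt0//; lra.
have erho : e * rho * (2 + 4 * A) = 1.
  by rewrite /rho; field; rewrite !gt_eqF//; lra.
have er0 : 0 < e * rho by rewrite mulr_gt0.
have Aer : 0 < A * (e * rho) by rewrite mulr_gt0.
exists rho => // z w zw.
have cle k : (0 < k)%N -> k`!%:R / pochhammer u k <= A * e ^+ k.
  by move=> k0; rewrite /A -mulrA -exprS; exact: Gamma_coef_le.
have erho2 : e * rho <= 2^-1 by lra.
have := Re_power_series_dist (Gamma_coef0 u1) (fun k => Gamma_coef_ge0 k u1)
  cle (ltW A0) (ltW e0) (ltW rho0) zw erho2.
rewrite -[limn _]/(bergman_kernel a z w) ler_norml => /andP[h1 h2].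
by apply/andP; split; lra.
Qed.

(** One small variable makes the inner product small uniformly in the other. The bounds with [w] in
    the box serve to apply the operator to an indicator; those with [z] in the box serve to show
    divergence at a point. *)
Lemma small_box_kernel (a : R) : a < - N%:R -> exists r : R,
  [/\ 0 < r, N%:R * (2 * r) ^+ 2 < 1,
    forall z w, B z -> small_box r w ->
      2^-1 <= complex.Re (bergman_kernel a z w) <= 3 / 2 &
    forall z w, small_box r z -> B w ->
      2^-1 <= complex.Re (bergman_kernel a z w)].
Proof.
move=> /bergman_kernel_near1[rho rho0 hrho].
(* With 2r = x = y/(N+1), the bound by [rho] gives N x <= rho for the kernel, and the bound by 1
   gives N x^2 < 1 for inclusion in the ball. *)
pose y := Num.min rho 1.
have y0 : 0 < y by rewrite lt_min rho0 ltr01.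
have y1 : y <= 1 by rewrite ge_min lexx orbT.
have yrho : y <= rho by rewrite ge_min lexx.
pose x := y / N.+1%:R; pose r := x / 2.
have x0 : 0 < x by rewrite divr_gt0.
have r0 : 0 < r by rewrite divr_gt0.
have xE : 2 * r = x by rewrite /r; field.
have Nx : N%:R * x + x = y.
  by rewrite -{2}(mul1r x) -mulrDl natr1 mulrC divfK.
have Nx0 : 0 <= N%:R * x by rewrite mulr_ge0// ltW.
exists r; split => //.
- by rewrite xE; nra.
- move=> z w Bz wr; apply: hrho.
  apply: le_trans (normc_inner_le (a := 1) (b := x) _ _ _ _) _ => //.
  + exact: ltW.
  + by move=> j; apply: le_trans (normc_tnth_le z j) (ltW Bz).
  + by move=> j; rewrite -xE; exact: normc_small_box.
  + by rewrite mul1r; lra.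
- move=> z w zr Bw.
  suff /hrho/andP[] : Normc.normc (inner z w) <= rho by [].
  apply: le_trans (normc_inner_le (a := x) (b := 1) _ _ _ _) _ => //.
  + exact: ltW.
  + by move=> j; rewrite -xE; exact: normc_small_box.
  + by move=> j; apply: le_trans (normc_tnth_le w j) (ltW Bw).
  + by rewrite mulr1; lra.
Qed.

End small_box.

(** The sign of [e] is arbitrary: the power is at most 1 if e >= 0 and at most m^e otherwise, and
    the sum covers both cases. *)
Lemma powR_itv_le (R : realType) (m x e : R) : 0 < m -> m <= x -> x <= 1 ->
  x `^ e <= 1 + m `^ e.
Proof.
move=> m0 mx x1; have x0 : 0 < x := lt_le_trans m0 mx.
have [e0|e0] := leP 0 e.
  apply: (@le_trans _ _ 1); last by rewrite lerDl powR_ge0.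
  by rewrite -(powRr0 x); apply: ger_powR => //; rewrite x0.
apply: (@le_trans _ _ (m `^ e)); last by rewrite lerDr.
rewrite -[e]opprK powRN [leRHS]powRN lef_pV2 ?posrE ?powR_gt0//.
by apply: ge0_ler_powR; rewrite ?nnegrE ?oppr_ge0 ?(ltW x0) ?(ltW m0) ?(ltW e0).
Qed.

Lemma powR_itv_ge (R : realType) (m x e : R) : 0 < m -> m <= x -> x <= 1 ->
  (1 + m `^ (- e))^-1 <= x `^ e.
Proof.
move=> m0 mx x1; have x0 : 0 < x := lt_le_trans m0 mx.
rewrite -[e in leRHS]opprK [leRHS]powRN lef_pV2 ?posrE ?powR_gt0//.
  exact: powR_itv_le.
by rewrite ltr_pwDl// powR_ge0.
Qed.

Lemma poweR_lty (R : realType) (x : \bar R) (e : R) : e != 0 ->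
  ((x `^ e < +oo) = (x < +oo))%E.
Proof.
by move=> e0; case: x => [x||] /=; rewrite ?(negbTE e0) ?ltry ?ltNyy.
Qed.

Lemma measurable_complex_of_real d (T : measurableType d) (R : realType)
    (g : T -> R) :
  measurable_fun setT g -> measurable_fun setT (fun x => (g x)%:C).
Proof.
move=> mg.
have -> : (fun x => (g x)%:C) = @pair_to_complex R \o (fun x => (g x, 0)) by [].
apply: (measurableT_comp (@measurable_pair_to_complex R)).
apply: measurable_fun_pair; [exact: mg | exact: measurable_cst].
Qed.

(** * Test functions and the contradiction *)

Section no_weight.
Variables (R : realType) (n : nat) (p q Q t s : R).
Local Notation N := n.+1.
Local Notation B := (unit_ball R N).
Local Notation mu := (mu R N).
Hypotheses (p1 : 1 < p) (stN : s + t < - (N%:R + 1)) (Qq : Q <= q).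
Variable om : N.-tuple R[i] -> R.
Hypothesis om_weight : is_weight om.
Hypothesis (om_bounded : bergman_op_bounded p q Q s t om).

Let p0 : 0 < p. Proof. by apply: lt_trans p1. Qed.

Let pV0 : p^-1 != 0. Proof. by rewrite invr_neq0 ?gt_eqF. Qed.

Let stN' : s + t < - N%:R. Proof. by have := stN; lra. Qed.

Let bergman_op_lty f : weighted_Lp p om q f ->
  (\int[mu]_(z in B) (Normc.normc (bergman_op s t f z) `^ p * om z *
     (1 - enorm z ^+ 2) `^ Q)%:E < +oo)%E.
Proof.
move=> fp; have [_ [C hC]] := om_bounded; have := hC f fp.
have [_] := fp.
have := poweR_ge0 (\int[mu]_(z in B) (Normc.normc (f z) `^ p * om z *
  (1 - enorm z ^+ 2) `^ q)%:E) p^-1.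
rewrite -/(weighted_Lnorm p om q f).
move: (weighted_Lnorm p om q f) => [x||]// x0 _ hX.
have : (weighted_Lnorm p om Q (bergman_op s t f) < +oo)%E.
  apply: le_lt_trans hX _.
  exact: ltry.
by rewrite /weighted_Lnorm poweR_lty.
Qed.

Section small_box_test_function.
Variable r : R.
Hypotheses (r0 : 0 < r) (Nr : N%:R * (2 * r) ^+ 2 < 1).
Local Notation K := (@small_box R N r).

Let m : R := 1 - N%:R * (2 * r) ^+ 2.

Let m0 : 0 < m. Proof. by rewrite subr_gt0. Qed.

Let KB : K `<=` B.
Proof. by move=> z; exact: small_box_ball Nr. Qed.

Let f1 (z : N.-tuple R[i]) : R[i] := (\1_K z)%:C.

(** On the box 1 - |z|^2 stays in [m, 1], so its power is bounded, and [om] is integrable over the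
    compact box. *)
Lemma weighted_Lp_small_box : weighted_Lp p om q f1.
Proof.
have [[mom omK] om0] := om_weight.
split.
  apply: measurable_funTS; apply: measurable_complex_of_real.
  apply: measurable_indic.
  exact: measurable_small_box.
rewrite /weighted_Lnorm poweR_lty//.
apply: (@le_lt_trans _ _ (\int[mu]_(z in K)
    ((1 + m `^ q)%:E * `|(om z)%:E|))%E).
  rewrite integral_mkcond [leRHS]integral_mkcond; apply: ae_le_integral.
  apply: filterS om0 => z om0 _; rewrite !patchE.
  have [zK|zK] := boolP (z \in K); last first.
    case: ifPn => [zB|_]; last by rewrite lexx.
    rewrite /f1 indicE (negbTE zK) Normc.normc0 powR0 ?gt_eqF//.
    by rewrite !mul0r lexx.
  move/set_mem : zK => zK; have zB := KB zK.
  have om1 := om0 zB.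
  rewrite mem_set// /f1 indicE mem_set// Normc.normc1 powR1 mul1r.
  rewrite abse_EFin -EFinM !lee_fin mulr_ge0 ?powR_ge0 ?(ltW om1)//=.
  rewrite (gtr0_norm om1) mulrC ler_pM2r//.
  apply: powR_itv_le => //; [exact: small_box_weight | exact: ball_weight_le1].
rewrite ge0_integralZl_EFin//.
- by rewrite lte_mul_pinfty ?lee_fin ?addr_ge0 ?powR_ge0//; apply: omK => //;
    exact: compact_small_box.
- exact: measurable_small_box.
- apply/measurable_EFinP; apply: measurableT_comp => //.
  exact: measurable_funS (@measurable_unit_ball R N) KB mom.
- by rewrite addr_ge0 ?powR_ge0.
Qed.

Hypothesis kernel_box : forall z w, B z -> K w ->
  2^-1 <= complex.Re (bergman_kernel (s + t) z w) <= 3 / 2.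

(** The real part of the integrand is at least [2^-1 * l] on the box and 0 off it, so the real part
    of the integral alone gives the bound. *)
Lemma bergman_op_small_box_ge : exists2 c : R, 0 < c &
  forall z, B z ->
    c * (1 - enorm z ^+ 2) `^ t <= Normc.normc (bergman_op s t f1 z).
Proof.
pose l := (1 + m `^ (- s))^-1.
have l0 : 0 < l by rewrite invr_gt0 ltr_pwDl// powR_ge0.
have muK : (0 < mu K < +oo)%E.
  rewrite mu_small_box_gt0//=; apply: le_lt_trans (mu_ball_lty R N).
  apply: le_measure; rewrite ?inE //.
    exact: measurable_small_box.
  exact: measurable_unit_ball.
have fmuK : 0 < fine (mu K) by rewrite fine_gt0.
exists (2^-1 * l * fine (mu K)); first by rewrite !mulr_gt0.
move=> z Bz; rewrite /bergman_op Normc.normcM.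
have -> : Normc.normc ((1 - enorm z ^+ 2) `^ t)%:C = (1 - enorm z ^+ 2) `^ t.
  by rewrite /= expr0n/= addr0 sqrtr_sqr ger0_norm ?powR_ge0.
rewrite mulrC ler_wpM2l ?powR_ge0//.
apply: le_trans (normc_ge_Re _) => /=; apply: le_trans (ler_norm _).
pose g w := complex.Re (bergman_integrand s t f1 z w).
have gE w : g w = complex.Re (bergman_kernel (s + t) z w) * \1_K w *
    (1 - enorm w ^+ 2) `^ s.
  rewrite /g /bergman_integrand /f1; case: (bergman_kernel _ _ _) => x y /=.
  by rewrite !mulr0 !subr0.
have gK w : K w -> 2^-1 * l <= g w <= 3 / 2 * (1 + m `^ s).
  move=> Kw; rewrite gE indicE mem_set// mulr1.
  have /andP[k1 k2] := kernel_box Bz Kw.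
  have w1 := powR_itv_ge s m0 (small_box_weight Kw) (ball_weight_le1 w).
  have w2 := powR_itv_le s m0 (small_box_weight Kw) (ball_weight_le1 w).
  by rewrite !ler_pM ?powR_ge0//; lra.
have gNK w : ~ K w -> g w = 0.
  by move=> Kw; rewrite gE indicE memNset// mulr0 mul0r.
have gB w : 0 <= g w <= 3 / 2 * (1 + m `^ s).
  have [Kw|Kw] := pselect (K w).
    have /andP[h ->] := gK _ Kw; rewrite andbT; apply: le_trans h.
    by rewrite mulr_ge0// ltW.
  by rewrite gNK// lexx/= mulr_ge0// addr_ge0// powR_ge0.
have lo : ((2^-1 * l * fine (mu K))%:E <= \int[mu]_(w in B) (g w)%:E)%E.
  rewrite EFinM fineK; last by rewrite gt0_fin_numE; case/andP: muK.
  apply: le_integral_of_cst => //.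
  - exact: measurable_small_box.
  - by rewrite mulr_ge0// ltW.
  - by move=> w /gK/andP[]; rewrite lee_fin.
  - by move=> w _; rewrite lee_fin; case/andP: (gB w).
(* The real-valued integral defaults to 0 when the extended one is infinite, so finiteness is needed
   to transfer the lower bound. *)
have up : (\int[mu]_(w in B) (g w)%:E < +oo)%E.
  apply: (@le_lt_trans _ _ (\int[mu]_(w in B) (3 / 2 * (1 + m `^ s))%:E)%E).
    by apply: ae_le_integral; apply: aeW => w _; rewrite !lee_fin.
  rewrite integral_cst; last exact: measurable_unit_ball.
  rewrite lte_mul_pinfty ?mu_ball_lty// lee_fin.
  by rewrite mulr_ge0// addr_ge0// powR_ge0.
rewrite -lee_fin /Rintegral fineK// ge0_fin_numE//.
by apply: integral_ge0 => w _; rewrite lee_fin; case/andP: (gB w).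
Qed.

End small_box_test_function.

Lemma weighted_Lp_weight_power : exists2 c : R, 0 < c &
  weighted_Lp p om q (fun z => (c * (1 - enorm z ^+ 2) `^ t)%:C).
Proof.
have [r [r0 Nr ker _]] := small_box_kernel stN'.
have [c c0 hc] := bergman_op_small_box_ge r0 Nr ker.
have [_ om0] := om_weight.
exists c => //; split.
  apply: measurable_funTS; apply: measurable_complex_of_real.
  apply: measurable_funM => //.
  exact: (measurableT_comp (measurable_powR t) (@measurable_weight R N)).
rewrite /weighted_Lnorm poweR_lty//.
apply: le_lt_trans (bergman_op_lty (weighted_Lp_small_box Nr)).
apply: ae_le_integral; apply: filterS om0 => z om0 Bz.
have om1 := om0 Bz; have w0 := ball_weight_gt0 Bz.
rewrite !lee_fin !mulr_ge0 ?powR_ge0 ?(ltW om1)//=.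
rewrite expr0n/= addr0 sqrtr_sqr ger0_norm; last first.
  by rewrite mulr_ge0 ?powR_ge0 ?(ltW c0).
apply: ler_pM; rewrite ?mulr_ge0 ?powR_ge0 ?(ltW om1)//.
  rewrite ler_pM2r//; apply: ge0_ler_powR; rewrite ?nnegrE ?normc_ge0//.
  - exact: ltW.
  - by rewrite mulr_ge0 ?powR_ge0 ?(ltW c0).
  - exact: hc.
(* Here [Q <= q] enters: as 0 < 1 - |z|^2 <= 1, the power with exponent [q] is at most the one with
   exponent [Q]. *)
by apply: ger_powR => //; rewrite w0 ball_weight_le1.
Qed.

Lemma no_weight : False.
Proof.
have [r [r0 Nr _ ker]] := small_box_kernel stN'.
have [c c0 fLp] := weighted_Lp_weight_power.
pose f (z : N.-tuple R[i]) : R[i] := (c * (1 - enorm z ^+ 2) `^ t)%:C.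
have [wd _] := om_bounded.
have [Z [mZ Z0 hZ]] := wd f fLp.
(* The box has positive measure, so it is not contained in the exceptional null set. *)
have [z Kz Zz] : exists2 z, small_box r z & ~ Z z.
  apply: contrapT => h.
  have KZ : small_box r `<=` Z.
    by move=> z Kz; apply: contrapT => Zz; apply: h; exists z.
  have := @mu_small_box_gt0 R N r r0.
  rewrite (subset_measure0 _ _ KZ Z0) ?ltxx//; exact: measurable_small_box.
have Bz : B z := small_box_ball Nr Kz.
have /integrableP[_] : mu.-integrable B
    (fun w => (Normc.normc (bergman_integrand s t f z w))%:E).
  by apply: contrapT => h; apply/Zz/hZ => /= /(_ Bz).
apply/negP; rewrite -leNgt leye_eq -leye_eq.
(* The exponent [t] comes from [f], the exponent [s] from the operator, and the factor 1/2 from the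
   kernel at [z] in the box. *)
apply: (@le_trans _ _ (\int[mu]_(w in B)
  ((2^-1 * c)%:E * ((1 - enorm w ^+ 2) `^ (s + t))%:E))%E).
  rewrite ge0_integralZl_EFin//.
  - rewrite power_integral_diverges; last by rewrite -(natr1 N); exact: ltW.
    by rewrite gt0_muley// lte_fin mulr_gt0.
  - exact: measurable_unit_ball.
  - by move=> w _; rewrite lee_fin powR_ge0.
  - apply/measurable_EFinP/measurable_funTS.
    exact: (measurableT_comp (measurable_powR _) (@measurable_weight R N)).
  - by rewrite mulr_ge0// ltW.
apply: ae_le_integral; apply: aeW => w Bw.
have w0 := ball_weight_gt0 Bw.
rewrite -EFinM abse_EFin !lee_fin mulr_ge0 ?powR_ge0//=; last first.
  by rewrite mulr_ge0// ltW.
rewrite ger0_norm ?normc_ge0//.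
rewrite /bergman_integrand /f !Normc.normcM.
have nC (x : R) : 0 <= x -> Normc.normc x%:C = x.
  by move=> x0; rewrite /= expr0n/= addr0 sqrtr_sqr ger0_norm.
rewrite !nC ?mulr_ge0 ?powR_ge0 ?(ltW c0)//.
rewrite powRD; last by rewrite (gt_eqF w0) implybT.
rewrite [_ `^ s * _]mulrC !mulrA ler_pM2r ?powR_gt0//.
rewrite ler_pM2r ?powR_gt0// ler_pM2r//.
apply: le_trans (normc_ge_Re _); apply: le_trans (ler_norm _).
exact: ker.
Qed.

End no_weight.

Unset Implicit Arguments.

Theorem theorem1p6 (R : realType) (N : nat) (p q Q t s : R) :
  (1 <= N)%N -> 1 < p -> -1 < s -> s + t < - (N%:R + 1) -> Q <= q ->
  ~ exists om : N.-tuple R[i] -> R,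
      is_weight om /\ bergman_op_bounded p q Q s t om.
Proof.
case: N => [//|n] _ p1 _ stN Qq [om [om_weight om_bounded]].
by have := no_weight p1 stN Qq om_weight om_bounded.
Qed.
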